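(* Let $p = 3$ and let $q > 3$ be a prime number. Then the Wiener index of the line graph $L(\Gamma(\mathbb{Z}_{3q}))$ is $W(L(\Gamma(\mathbb{Z}_{3q}))) = (q-1)(3q-p-2)$.
   Context: For a positive integer $n$, $\mathbb{Z}_n$ is the ring of residue classes modulo $n$. The zero-divisor graph $\Gamma(\mathbb{Z}_n)$ is the simple undirected graph whose vertices are the nonzero zero-divisors of $\mathbb{Z}_n$ (nonzero $x \in \mathbb{Z}_n$ such that $xy = 0$ for some nonzero $y \in \mathbb{Z}_n$), with distinct vertices $x,y$ adjacent if and only if $xy=0$. The line graph $L(\Gamma(\mathbb{Z}_n))$ is the graph whose vertices are the edges of $\Gamma(\mathbb{Z}_n)$, two distinct vertices being adjacent if the corresponding edges share a common vertex in $\Gamma(\mathbb{Z}_n)$. The Wiener index of a finite connected graph $G$ with vertex set $V$ is $W(G) = \frac{1}{2}\sum_{x,y \in V} d(x,y)$, the sum being over all ordered pairs $(x,y)$, where $d(x,y)$ is the length of a shortest path between $x$ and $y$. *)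

(* Defs.v *)
From HB Require Import structures.
From mathcomp Require Import all_boot all_order all_algebra.

Set Implicit Arguments.
Unset Strict Implicit.
Unset Printing Implicit Defensive.

Import GRing.Theory.
Local Open Scope ring_scope.

Record sgraph := SGraph {
  vertex :> finType;
  adj : rel vertex;
  adj_sym : symmetric adj;
  adj_irrefl : irreflexive adj }.

Definition is_zero_divisor (R : finComNzRingType) (x : R) : bool :=
  [exists y : R, (y != 0) && (x * y == 0)].

Definition zd_vertex (R : finComNzRingType) : finType :=
  {x : R | (x != 0) && is_zero_divisor x}.

Definition zd_adj (R : finComNzRingType) : rel (zd_vertex R) :=
  fun x y => (x != y) && (val x * val y == 0).

Lemma zd_adj_sym (R : finComNzRingType) : symmetric (@zd_adj R).
Proof. by move=> x y; rewrite /zd_adj eq_sym mulrC. Qed.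

Lemma zd_adj_irrefl (R : finComNzRingType) : irreflexive (@zd_adj R).
Proof. by move=> x; rewrite /zd_adj eqxx. Qed.

Definition zero_divisor_graph (R : finComNzRingType) : sgraph :=
  SGraph (@zd_adj_sym R) (@zd_adj_irrefl R).

Definition edges (G : sgraph) : {set {set G}} :=
  [set e : {set G} | [exists x : G, exists y : G, adj x y && (e == [set x; y])]].

Definition line_vertex (G : sgraph) : finType := {e : {set G} | e \in edges G}.

Definition line_adj (G : sgraph) : rel (line_vertex G) :=
  fun e f => (e != f) && (val e :&: val f != set0).

Lemma line_adj_sym (G : sgraph) : symmetric (@line_adj G).
Proof. by move=> e f; rewrite /line_adj eq_sym setIC. Qed.

Lemma line_adj_irrefl (G : sgraph) : irreflexive (@line_adj G).
Proof. by move=> e; rewrite /line_adj eqxx. Qed.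

Definition line_graph (G : sgraph) : sgraph :=
  SGraph (@line_adj_sym G) (@line_adj_irrefl G).

Definition has_walk (G : sgraph) (x y : G) (k : nat) : bool :=
  [exists t : k.-tuple G, path (@adj G) x t && (last x t == y)].

(* The least k < #|G| such that some walk of length k joins x to y.  A shortest
   path has fewer than #|G| edges, so the bound is harmless (see dist_walk and
   dist_min); if x and y are not connected, the value is #|G| by convention. *)
Definition dist (G : sgraph) (x y : G) : nat :=
  find (has_walk x y) (iota 0 #|G|).

Lemma has_walkP (G : sgraph) (x y : G) (k : nat) :
  reflect (exists s : seq G, [/\ path (@adj G) x s, last x s = y & size s = k])
          (has_walk x y k).
Proof.
apply: (iffP existsP) => [[t /andP[pt /eqP lt]]|[s [ps ls /eqP sk]]].
  by exists t; rewrite size_tuple.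
by exists (Tuple sk); rewrite /= ps ls eqxx.
Qed.

Lemma dist_min (G : sgraph) (x y : G) (s : seq G) :
  path (@adj G) x s -> last x s = y -> (dist x y <= size s)%N.
Proof.
move=> ps ls; rewrite leqNgt; apply/negP => lt_s.
have s_lt : (size s < #|G|)%N.
  by apply: leq_trans lt_s _; rewrite -[leqRHS](size_iota 0); apply: find_size.
move/(before_find 0%N): lt_s; rewrite nth_iota // add0n.
by move/has_walkP; apply; exists s.
Qed.

Lemma dist_walk (G : sgraph) (x y : G) :
  connect (@adj G) x y ->
  exists s : seq G,
    [/\ path (@adj G) x s, last x s = y & size s = dist x y].
Proof.
case/connectP=> s0 ps0 ->; case/shortenP: ps0 => s ps us _.
have s_lt : (size s < #|G|)%N.
  by have /card_uniqP/= <- := us; apply: max_card.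
have hw : has (has_walk x (last x s)) (iota 0 #|G|).
  apply/hasP; exists (size s); first by rewrite mem_iota.
  by apply/has_walkP; exists s.
have := nth_find 0%N hw; rewrite nth_iota ?add0n => [/has_walkP //|].
by rewrite -[ltnRHS](size_iota 0) -has_find.
Qed.

(* Intended for connected graphs only. *)
Definition wiener_index (G : sgraph) : rat :=
  2%:R^-1 * \sum_(x : G) \sum_(y : G) (dist x y)%:R.

(* Main.v *)
(** For distinct primes [p] and [q], the zero-divisor graph of [Z/pq] is complete bipartite,
    with the multiples of [p] and the multiples of [q] as parts, of sizes [m = q - 1] and
    [n = p - 1].  Two edges [e], [f] of a complete bipartite graph are at distance
    [2 - #|e :&: f|] in the line graph, whatever their relative position.  Counting the edges
    through each vertex gives [mn] edges and [\sum_(e, f) #|e :&: f| = \sum_v (deg v)^2 =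
    m n^2 + n m^2], so the Wiener index is [mn (2mn - m - n) / 2]. *)
Require Import Defs.
From mathcomp Require Import all_boot all_order all_algebra.
From mathcomp Require Import zify ring lra.

Import GRing.Theory.
Local Open Scope ring_scope.

(** * Incidence counts and short distances in a simple graph *)

Lemma edgesP (G : sgraph) (e : {set G}) :
  reflect (exists x y : G, adj x y /\ e = [set x; y]) (e \in edges G).
Proof.
rewrite inE; apply: (iffP existsP) => [[x /existsP[y /andP[xy /eqP ->]]]|[x [y [xy ->]]]].
  by exists x, y.
by exists x; apply/existsP; exists y; rewrite xy eqxx.
Qed.

Lemma adj_neq (G : sgraph) (x y : G) : adj x y -> x != y.
Proof. by apply: contraTneq => ->; rewrite adj_irrefl. Qed.

Definition deg (G : sgraph) (v : G) : nat := #|[set w | adj v w]|.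

(** The map [w |-> [set v; w]] is a bijection from the neighbours of [v] to the edges through
    [v]. *)
Lemma card_incident_edges (G : sgraph) (v : G) :
  #|[set e in edges G | v \in e]| = deg G v.
Proof.
rewrite /deg -(card_in_imset (f := fun w => [set v; w])); last first.
  move=> w1 w2; rewrite !inE => vw1 vw2 /setP/(_ w1).
  by rewrite !inE eqxx orbT (eq_sym w1 v) (negPf (adj_neq _ _ _ vw1)) => /esym/eqP.
apply: eq_card => e; rewrite inE; apply/andP/imsetP.
  case=> /edgesP[x [y [xy ->]]]; rewrite !inE => /orP[]/eqP ->.
    by exists y; rewrite // inE.
  by exists x; rewrite ?inE 1?adj_sym // setUC.
by case=> w; rewrite inE => vw ->; split; [apply/edgesP; exists v, w | rewrite !inE eqxx].
Qed.

Lemma sum_incident_edges (G : sgraph) (v : G) :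
  (\sum_(e in edges G) (v \in e) = deg G v)%N.
Proof.
rewrite -card_incident_edges -sum1_card (eq_bigl _ _ (in_set _)) big_mkcondr.
by apply: eq_bigr => e _; case: (v \in e).
Qed.

Lemma card_sum_mem (T : finType) (A : {set T}) : (#|A| = \sum_x (x \in A))%N.
Proof. by rewrite -sum1_card big_mkcond; apply: eq_bigr => x _; case: (x \in A). Qed.

(** Double counting of incident pairs [(v, e)]: each edge has exactly two ends, as adjacency is
    irreflexive. *)
Lemma handshake (G : sgraph) : (2 * #|edges G| = \sum_v deg G v)%N.
Proof.
under eq_bigr do rewrite -sum_incident_edges.
rewrite exchange_big /= mulnC -sum_nat_const; apply: eq_bigr => e /edgesP[x [y [xy ->]]].
by rewrite -card_sum_mem cards2 (adj_neq _ _ _ xy).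
Qed.

(** Both sides count triples [(v, e, f)] with [v] in [e] and in [f]; for fixed [v], the edges [e]
    and [f] vary independently. *)
Lemma sum_card_edgesI (G : sgraph) :
  (\sum_(e in edges G) \sum_(f in edges G) #|e :&: f| = \sum_v deg G v ^ 2)%N.
Proof.
under eq_bigr => e _ do under eq_bigr => f _ do rewrite card_sum_mem.
under eq_bigr => e _ do rewrite exchange_big /=.
rewrite exchange_big /=; apply: eq_bigr => v _.
rewrite -mulnn -{1}sum_incident_edges big_distrl /=; apply: eq_bigr => e _.
rewrite -sum_incident_edges big_distrr /=; apply: eq_bigr => f _.
by rewrite inE; case: (v \in e) (v \in f) => [] [].
Qed.

Lemma dist_diam2 (G : sgraph) (x y : G) :
  (x != y -> ~~ adj x y -> exists z, adj x z && adj z y) ->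
  dist x y = ((x != y) + ((x != y) && ~~ adj x y))%N.
Proof.
move=> mid.
have le (s : seq G) : path (@adj G) x s -> last x s = y -> (dist x y <= size s)%N.
  exact: dist_min.
(* The lower bound reads off a shortest walk of length 0, 1 or more. Connectedness is what provides
   such a walk; each case below supplies it. *)
have ge : connect (@adj G) x y ->
    ((x != y) + ((x != y) && ~~ adj x y) <= dist x y)%N.
  case/dist_walk=> -[|z [|t s]] [/= + + <-].
  - by move=> _ ->; rewrite eqxx.
  - by rewrite andbT => xz <-; rewrite xz andbF addn0 leq_b1.
  - by move=> _ _; apply: (@leq_trans (1 + 1)) => //; apply: leq_add; apply: leq_b1.
apply/eqP; rewrite eqn_leq.
case: (eqVneq x y) mid le ge => [-> _ le _|ne mid le ge] /=.
  by rewrite (le [::]).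
case: (boolP (adj x y)) mid le ge => xy mid le ge /=.
  by rewrite (le [:: y]) /= ?xy // ge // connect1.
have [z /andP[xz zy]] := mid isT isT.
rewrite (le [:: z; y]) /= ?xz ?zy // ge //.
exact: connect_trans (connect1 xz) (connect1 zy).
Qed.

(** * The line graph of a complete bipartite graph *)

Section CompleteBipartite.

Variables (G : sgraph) (A : {set G}).
(** The exclusive or makes [G] complete bipartite with parts [A] and [~: A]. *)
Hypothesis adjE : forall x y : G, adj x y = (x \in A) (+) (y \in A).

Lemma bipartite_edgesP (e : {set G}) :
  reflect (exists a b : G, [/\ a \in A, b \notin A & e = [set a; b]]) (e \in edges G).
Proof.
apply: (iffP (edgesP G e)) => [[x [y [xy ->]]]|[a [b [aA bA ->]]]]; last first.
  by exists a, b; rewrite adjE aA (negPf bA).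
move: xy; rewrite adjE; case: (boolP (x \in A)) => xA /= yA.
  by exists x, y.
by exists y, x; split=> //; rewrite setUC.
Qed.

Lemma deg_bipartite (v : G) : deg G v = if v \in A then #|~: A| else #|A|.
Proof.
rewrite /deg; case: ifP => vA; apply: eq_card => w; rewrite !inE adjE vA //.
Qed.

Lemma card_edges_bipartite : #|edges G| = (#|A| * #|~: A|)%N.
Proof.
have := handshake G; rewrite (bigID (mem A)) /=.
under eq_bigr => v vA do rewrite deg_bipartite vA.
under [X in (_ + X)%N]eq_bigr => v vA do rewrite deg_bipartite (negPf vA).
rewrite sum_nat_const (eq_bigl (mem (~: A))); last by move=> v; rewrite /= inE.
rewrite sum_nat_const; lia.
Qed.

Lemma sum_deg2_bipartite :
  (\sum_v deg G v ^ 2 = #|A| * #|~: A| ^ 2 + #|~: A| * #|A| ^ 2)%N.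
Proof.
rewrite (bigID (mem A)) /=.
under eq_bigr => v vA do rewrite deg_bipartite vA.
under [X in (_ + X)%N]eq_bigr => v vA do rewrite deg_bipartite (negPf vA).
rewrite sum_nat_const (eq_bigl (mem (~: A))); last by move=> v; rewrite /= inE.
by rewrite sum_nat_const.
Qed.

(** Equal edges share two vertices, adjacent ones share one, and two disjoint edges are both met by
    a third edge. The additive form avoids truncated subtraction. *)
Lemma dist_line_bipartite (e f : line_graph G) :
  (dist e f + #|val e :&: val f| = 2)%N.
Proof.
have /bipartite_edgesP[a [b [aA bA Ee]]] := valP e.
have /bipartite_edgesP[c [d [cA dA Ef]]] := valP f.
have ne x y : x \in A -> y \notin A -> (x == y) = false.
  by move=> xA; apply: contraNF => /eqP <-.
have ab := ne a b aA bA; have ad := ne a d aA dA.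
have cb := ne c b cA bA; have cd := ne c d cA dA.
(* Only ends in the same part can coincide. *)
have cardI : #|val e :&: val f| = ((a == c) + (b == d))%N.
  rewrite Ee Ef -sum1_card.
  rewrite (eq_bigl (fun x => (x \in [set a; b]) && (x \in [set c; d]))) => [|x];
    last by rewrite inE.
  rewrite big_mkcondr /=.
  rewrite big_setU1 ?inE ?ab // big_set1 !inE ad (eq_sym b c) cb orbF.
  by case: (a == c) (b == d) => [] [].
have efE : (e == f) = (a == c) && (b == d).
  rewrite -val_eqE /= Ee Ef; apply/eqP/andP => [/setP E|[/eqP -> /eqP -> //]].
  have := E a; have := E b; rewrite !inE !eqxx ad (eq_sym b c) cb orbT orbF /=.
  by move=> <- <-.
have adj_ef : adj e f = (e != f) && ((a == c) || (b == d)).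
  rewrite /adj /= /line_adj -cards_eq0 cardI; congr (_ && _).
  by case: (a == c) (b == d) => [] [].
rewrite dist_diam2 ?adj_ef ?cardI; last first.
  move=> -> /=; rewrite negb_or => /andP[ac bd].
  (* The edge [[set a; d]] meets [e] in [a] and [f] in [d], and differs from both since [a != c] and
     [b != d]. *)
  have adE : [set a; d] \in edges G by apply/bipartite_edgesP; exists a, d.
  exists (Sub [set a; d] adE : line_graph G).
  have lineE (x y : line_vertex G) :
    line_adj x y = (val x != val y) && (val x :&: val y != set0) by [].
  rewrite !lineE !SubK Ee Ef; apply/andP; split; apply/andP; split.
  - apply/eqP => /setP/(_ b); rewrite !inE eqxx orbT (eq_sym b a) ab.
    by rewrite (negPf bd).
  - by apply/set0Pn; exists a; rewrite !inE eqxx.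
  - apply/eqP => /setP/(_ a); rewrite !inE eqxx ad.
    by rewrite (negPf ac).
  - by apply/set0Pn; exists d; rewrite !inE eqxx !orbT.
by rewrite efE; case: (a == c) (b == d) => [] [].
Qed.

Lemma wiener_line_bipartite (m := #|A|) (n := #|~: A|) :
  wiener_index (line_graph G) =
  m%:R * n%:R * (2%:R * m%:R * n%:R - m%:R - n%:R) / 2%:R.
Proof.
have sumI : (\sum_(e : line_graph G) \sum_(f : line_graph G) #|val e :&: val f| =
    m * n ^ 2 + n * m ^ 2)%N.
  rewrite -sum_deg2_bipartite -sum_card_edgesI [RHS]big_sub.
  by apply: eq_bigr => e _; rewrite [RHS]big_sub.
have cardL : #|line_graph G| = (m * n)%N.
  by rewrite card_sub -card_edges_bipartite; apply: eq_card.
(* Sum of the preceding identity over all [(m * n) ^ 2] ordered pairs of edges. *)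
have sum2 : (\sum_(e : line_graph G) \sum_(f : line_graph G) dist e f +
    (m * n ^ 2 + n * m ^ 2) = 2 * (m * n) ^ 2)%N.
  rewrite -sumI -big_split /=.
  under eq_bigr => e _ do
    rewrite -big_split /= (eq_bigr _ (fun f _ => dist_line_bipartite e f)) sum_nat_const.
  by rewrite sum_nat_const cardL; lia.
have {sum2} := congr1 (fun k : nat => k%:R : rat) sum2.
rewrite /wiener_index; under [X in _ -> _ * X = _]eq_bigr do rewrite -natr_sum.
rewrite -natr_sum; move: (\sum_e _)%N => S.
by rewrite !(natrD, natrM, natrX) => ES; lra.
Qed.

End CompleteBipartite.

(** * The zero-divisor graph of the integers modulo [p * q] *)

Lemma Zp_mul_eq0 (n : nat) (x y : 'Z_n) :
  (1 < n)%N -> (x * y == 0) = (n %| x * y)%N.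
Proof. by move=> n1; rewrite -val_eqE /= /dvdn; congr (_ %% _ == _)%N; apply: Zp_cast. Qed.

Lemma card_multiples_Zp (p q : nat) :
  (0 < p)%N -> (1 < p * q)%N ->
  #|[set x : 'Z_(p * q) | (x != 0) && (p %| x)%N]| = q.-1.
Proof.
move=> p0 pq1; have q0 : (0 < q)%N by case: q pq1; rewrite ?muln0.
have ltpq (i : 'I_q.-1) : (p * i.+1 < (Zp_trunc (p * q)).+2)%N.
  by rewrite Zp_cast // ltn_pmul2l //; have := ltn_ord i; lia.
rewrite -[RHS]card_ord -cardsT -(card_imset (f := fun i => Ordinal (ltpq i)));
  last first.
  move=> i j [] /eqP; rewrite eqn_pmul2l // => /eqP [] ij; exact: val_inj.
apply: eq_card => x; rewrite inE -val_eqE /=; apply/andP/imsetP => [[x0 px]|[i _ ->]].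
  have ltx : (x < p * q)%N by rewrite -[ltnRHS]Zp_cast.
  case/dvdnP: px => k xk.
  (* The quotient [k] lies between 1 and [q - 1], whereas ordinals start at 0, hence the shift. *)
  have k_lt : (k.-1 < q.-1)%N.
    move: ltx x0; rewrite xk mulnC ltn_pmul2l //; case: k {xk} => //; lia.
  exists (Ordinal k_lt); rewrite // ; apply: val_inj => /=.
  by rewrite xk mulnC prednK //; case: k xk x0 {k_lt} => //= ->.
by rewrite /= dvdn_mulr // muln_eq0 /= orbF -lt0n.
Qed.

Lemma wiener_line_zero_divisor (p q : nat) :
  prime p -> prime q -> p != q ->
  wiener_index (line_graph (zero_divisor_graph 'Z_(p * q))) =
  (p%:R - 1) * (q%:R - 1) *
  (2%:R * (p%:R - 1) * (q%:R - 1) - (p%:R - 1) - (q%:R - 1)) / 2%:R.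
Proof.
move=> pp qp neq.
have [p1 q1] := (prime_gt1 pp, prime_gt1 qp).
have cop : coprime p q by rewrite prime_coprime // dvdn_prime2.
have n1 : (1 < p * q)%N by nia.
have n1' : (1 < q * p)%N by rewrite mulnC.
(* By coprimality [p * q] would divide a positive representative smaller than itself. *)
have nz (x : 'Z_(p * q)) : x != 0 -> (p %| x)%N -> (q %| x)%N -> False.
  move=> x0 px qx; have : (p * q %| x)%N by rewrite Gauss_dvd // px.
  have ltx : (x < p * q)%N by rewrite -[ltnRHS]Zp_cast.
  move/dvdn_leq; rewrite lt0n => /(_ x0); lia.
(* Multiples of [p] are annihilated by [q] and conversely. If neither prime divides [x], then
   [x * y = 0] forces both to divide [y], so [y = 0]. *)
have zdE (x : 'Z_(p * q)) :
    (x != 0) && is_zero_divisor x = (x != 0) && ((p %| x) || (q %| x))%N.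
  case: (boolP (x == 0)) => //= x0; apply/existsP/idP => [[y /andP[y0]]|].
    rewrite Zp_mul_eq0 // Gauss_dvd // !Euclid_dvdM //.
    by case: (p %| x)%N (q %| x)%N => [] [] //= /andP[py qy]; case: (nz y).
  have ltp : (p < (Zp_trunc (p * q)).+2)%N by rewrite Zp_cast //; nia.
  have ltq : (q < (Zp_trunc (p * q)).+2)%N by rewrite Zp_cast //; nia.
  case/orP=> dx.
    exists (Ordinal ltq : 'Z_(p * q)); rewrite Zp_mul_eq0 // -val_eqE /=.
    by rewrite dvdn_mul // andbT; lia.
  exists (Ordinal ltp : 'Z_(p * q)); rewrite Zp_mul_eq0 // -val_eqE /= [(x * p)%N]mulnC.
  by rewrite dvdn_mul // andbT; lia.
pose G := zero_divisor_graph 'Z_(p * q).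
pose A := [set x : G | p %| (val x : 'Z_(p * q))]%N.
(* Each vertex is divisible by exactly one of the two primes, so [~: A] consists of the multiples of
   [q]. *)
have q_dvd (x : G) : (q %| (val x : 'Z_(p * q)))%N = (x \notin A).
  have := valP x; rewrite zdE inE => /andP[x0 /orP[]] dx; rewrite dx ?orbT /=.
    by apply/negP => qx; apply: (nz (val x)).
  by apply/esym/negP => px; apply: (nz (val x)).
(* A product vanishes when some factor is in [A] and some factor is outside it; for [x = y] both
   sides are false. *)
have adjE (x y : G) : adj x y = (x \in A) (+) (y \in A).
  rewrite /adj /= /zd_adj Zp_mul_eq0 // Gauss_dvd // !Euclid_dvdM // !q_dvd.
  rewrite -!(in_set (fun x : G => p %| (val x : 'Z_(p * q)))%N) -/A.
  case: eqVneq => [->|_]; first by rewrite addbb.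
  by case: (x \in A) (y \in A) => [] [].
(* Moves the count from the vertex subtype to the ring: nonzero elements satisfying [P] are all
   vertices. *)
have card_part (P : pred 'Z_(p * q)) :
    (forall x : 'Z_(p * q), P x -> (p %| x) || (q %| x))%N ->
    #|[set x : G | P (val x)]| = #|[set x : 'Z_(p * q) | (x != 0) && P x]|.
  move=> P_zd; rewrite -(card_imset _ val_inj); apply: eq_card => x; rewrite inE.
  apply/imsetP/andP => [[y]|[x0 Px]].
    by rewrite inE => Py ->; split=> //; case/andP: (valP y).
  have vx : (x != 0) && is_zero_divisor x by rewrite zdE x0 P_zd.
  by exists (Sub x vx : G); rewrite ?inE SubK.
have cA : #|A| = q.-1.
  by rewrite (card_part (fun x => p %| x)%N) ?card_multiples_Zp ?(ltnW p1) // => x ->.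
have cAC : #|~: A| = p.-1.
  have -> : ~: A = [set x : G | q %| (val x : 'Z_(p * q))]%N.
    by apply/setP => x; rewrite in_setC [RHS]inE q_dvd.
  rewrite (card_part (fun x => q %| x)%N) => [|x ->]; last by rewrite orbT.
  by rewrite mulnC card_multiples_Zp ?(ltnW q1).
rewrite (wiener_line_bipartite G A adjE) cA cAC -!subn1 !natrB ?(ltnW p1) ?(ltnW q1) //.
ring.
Qed.

Theorem theorem3p6 (p q : nat) (hp : p = 3%N) (hq : prime q) (hq3 : (3 < q)%N) :
  wiener_index (line_graph (zero_divisor_graph 'Z_(3 * q))) =
  (q%:R - 1) * (3%:R * q%:R - p%:R - 2%:R) :> rat.
Proof.
(* With [p = 3] the general value is [2(q-1)(4(q-1) - 2 - (q-1))/2 = (q-1)(3q-5)]. *)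
rewrite hp wiener_line_zero_divisor ?neq_ltn ?hq3 //.
by field.
Qed.
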